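(* Let $q=ef+1=\epsilon\rho+1$ be a prime power, where $e,f,\epsilon,\rho>1$ are integers, $\epsilon\mid e$ and $e>\epsilon$. Let ${C_0^\epsilon}'=\{C_0^e,C_\epsilon^e,\ldots,C_{e-\epsilon}^e\}$ and suppose ${C_0^\epsilon}'$ is a $(q,\frac{e}{\epsilon},f,\phi_0,\phi_1)$-disjoint partial difference family. (i) If $\epsilon>f$, then $\phi_0=f-1$ and $\phi_1=0$, i.e. ${C_0^\epsilon}'$ is a $(q,\frac{e}{\epsilon},f,f-1,0)$-disjoint partial difference family. (ii) If $\epsilon>2$ and $\epsilon=f$, then ${C_0^\epsilon}'$ is a $(q,\frac{e}{\epsilon},f,f-1,0)$-disjoint partial difference family. (iii) If moreover $C_0^\epsilon$ is a $(q,\rho,\lambda,\mu)$-partial difference set, then in both cases (i) and (ii), ${C_0^\epsilon}'$ is a $(q,\frac{e}{\epsilon},f,\lambda-f+1,\mu)$-external partial difference family, which is proper unless $\mu-\lambda=f-1$.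
   Context: $G=(GF(q),+)$, $G^*=G\setminus\{0\}$; $\alpha$ a primitive element; $C_i^d=\alpha^i\langle\alpha^d\rangle$ for $d\mid q-1$; the sets of ${C_0^\epsilon}'$ partition $C_0^\epsilon$. $\Delta(D)$ is the multiset $\{x-y:x,y\in D,x\neq y\}$, $\Delta(D_1,D_2)$ the multiset $\{x-y:x\in D_1,y\in D_2\}$, $\lambda A$ is $\lambda$ copies of each element of $A$. $P$ is a $(q,k,\lambda,\mu)$-partial difference set if $|P|=k$ and $\Delta(P)=\lambda P+\mu(G^*\setminus P)$. For a family of $m$ disjoint $k$-subsets $D_i$ of $G^*$ with union $S$: $(q,m,k,\lambda,\mu)$-disjoint (resp. external) partial difference family means $\bigcup_i\Delta(D_i)$ (resp. $\bigcup_{i\neq j}\Delta(D_i,D_j)$) equals $\lambda S+\mu(G^*\setminus S)$; proper means $\lambda\neq\mu$.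
   Formalization: In (iii), ''proper unless μ−λ=f−1'' is a sign slip (it fails for q=64, f=ε=3, where λ=8, μ=6); the formal statement proves instead that the external family is proper if and only if λ−μ≠f−1. *)

(* Defs.v *)
From mathcomp Require Import all_boot all_order all_algebra.

Set Implicit Arguments.
Unset Strict Implicit.
Unset Printing Implicit Defensive.

Import GRing.Theory.
Local Open Scope ring_scope.

(* Finite multisets are sequences, compared with perm_eq; sums of multisets
   are concatenations. *)

Section Families.
Variable G : finZmodType.
Implicit Types (A B P : {set G}) (v m k lam mu : nat).

Definition delta A : seq G := [seq x - y | x <- enum A, y <- enum (A :\ x)].

Definition delta2 A B : seq G := [seq x - y | x <- enum A, y <- enum B].

Definition copies n A : seq G := flatten (nseq n (enum A)).

(* lam A + mu (G^* \ A) *)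
Definition two_valued lam mu A : seq G :=
  copies lam A ++ copies mu ([set~ 0] :\: A).

Definition is_pds v k lam mu P : Prop :=
  [/\ #|G| = v, #|P| = k & perm_eq (delta P) (two_valued lam mu P)].

Definition disjoint_family v m k (D : 'I_m -> {set G}) : Prop :=
  [/\ #|G| = v, forall i, D i \subset [set~ 0], forall i, #|D i| = k
    & forall i j, i != j -> [disjoint D i & D j]].

Definition is_dpdf v m k lam mu (D : 'I_m -> {set G}) : Prop :=
  disjoint_family v k D /\
  perm_eq (flatten [seq delta (D i) | i <- enum 'I_m])
          (two_valued lam mu (\bigcup_i D i)).

Definition is_epdf v m k lam mu (D : 'I_m -> {set G}) : Prop :=
  disjoint_family v k D /\
  perm_eq (flatten [seq delta2 (D i) (D j) | i <- enum 'I_m,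
                                             j <- enum [set~ i]])
          (two_valued lam mu (\bigcup_i D i)).

Definition is_proper_epdf v m k lam mu (D : 'I_m -> {set G}) : Prop :=
  is_epdf v k lam mu D /\ lam <> mu.

End Families.

Arguments disjoint_family {G} v m k D.
Arguments is_dpdf {G} v m k lam mu D.
Arguments is_epdf {G} v m k lam mu D.
Arguments is_proper_epdf {G} v m k lam mu D.

Section Cyclotomy.
Variables (F : finFieldType) (alpha : F).

Definition primitive_element : Prop := (#|F|.-1).-primitive_root alpha.

(* alpha^i <alpha^d>; for d dividing #|F| - 1 and alpha primitive, alpha^d has
   order (#|F| - 1) / d. *)
Definition cyclotomic_class (d i : nat) : {set F} :=
  [set alpha ^+ i * (alpha ^+ d) ^+ j | j : 'I_(#|F|.-1 %/ d)].

(* The classes C_0^e, C_eps^e, ..., C_(e - eps)^e. *)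
Definition cyclotomic_family (e eps : nat) (i : 'I_(e %/ eps)) : {set F} :=
  cyclotomic_class e (eps * i).

End Cyclotomy.

Arguments cyclotomic_family {F} alpha e eps i.

(* Main.v *)
Require Import Defs.
From mathcomp Require Import all_boot all_order all_algebra.
From mathcomp Require Import finfield zify.
Import GRing.Theory.
Local Open Scope ring_scope.

(** Write [m = e / eps] and let [S = C_0^eps] be the union of the family.
Counting the internal differences of the family in two ways gives
[f - 1 = phi0 + (eps - 1) phi1], because [S] has [m f] elements and [G^*] has
[eps m f].  If [f < eps] this forces [phi1 = 0]; if [f = eps] the only other
solution is [phi0 = 0, phi1 = 1].  In that case [-1] belongs to [S], and for
[x = alpha^e] the difference [x - 1 = (-1) - (-x)] arises from two distinct
pairs, each contained in a class of the family, since [x != -1] as soon as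
[f > 2]; so some multiplicity is at least 2, a contradiction.  Finally the
external differences are what remains of the differences of [S] once the
internal ones are removed. *)

(** * Differences counted with multiplicity in a finite abelian group *)

Section DifferenceCounts.
Set Implicit Arguments.
Unset Strict Implicit.
Variable G : finZmodType.
Implicit Types (A B : {set G}) (z : G).

(** Number of representations [z = x - y] with [x] in [A] and [y] in [B], indexed by [x] alone since
    [y = x - z]. Products of indicators let sums be exchanged freely. *)
Definition diff_count A B z : nat := (\sum_x (x \in A) * ((x - z)%R \in B))%N.

Lemma count_mem_enum A z : count_mem z (enum A) = (z \in A).
Proof. by rewrite count_uniq_mem ?enum_uniq // mem_enum. Qed.

Lemma count_sub_enum A x z :
  count_mem z [seq x - y | y <- enum A] = (x - z \in A).
Proof.
rewrite count_map -(count_mem_enum A); apply: eq_count => y /=.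
by rewrite subr_eq [RHS]eq_sym subr_eq addrC.
Qed.

Lemma count_delta2 A B z : count_mem z (delta2 A B) = diff_count A B z.
Proof.
rewrite /delta2 count_flatten sumnE 2!big_map big_enum /= /diff_count.
rewrite big_mkcond; apply: eq_bigr => x _.
by case: (x \in A); rewrite ?mul0n // mul1n count_sub_enum.
Qed.

(** The pairs [x = y] left out of [delta] only affect the difference 0. *)
Lemma count_delta A z :
  count_mem z (delta A) = ((z != 0%R) * diff_count A A z)%N.
Proof.
rewrite /delta count_flatten sumnE 2!big_map big_enum /= /diff_count.
rewrite big_distrr big_mkcond; apply: eq_bigr => x _ /=.
case: (x \in A); rewrite ?mul0n ?muln0 // mul1n count_sub_enum !inE.
by rewrite -subr_eq0 addrAC subrr add0r oppr_eq0 mulnb.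
Qed.

Lemma count_copies n A z : count_mem z (copies n A) = (n * (z \in A))%N.
Proof.
by rewrite /copies count_flatten map_nseq sumn_nseq count_mem_enum mulnC.
Qed.

Lemma count_two_valued lam mu A z :
  count_mem z (two_valued lam mu A) =
  (lam * (z \in A) + mu * ((z \notin A) && (z != 0%R)))%N.
Proof. by rewrite count_cat !count_copies !inE. Qed.

Lemma size_delta A : size (delta A) = (#|A| * #|A|.-1)%N.
Proof.
rewrite size_flatten /shape sumnE 2!big_map big_enum /=.
rewrite (eq_bigr (fun=> #|A|.-1)) ?sum_nat_const // => x xA.
by rewrite size_map -cardE (cardsD1 x A) xA.
Qed.

Lemma size_two_valued lam mu A : A \subset [set~ 0] ->
  size (two_valued lam mu A) = (lam * #|A| + mu * (#|G|.-1 - #|A|))%N.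
Proof.
move=> A0; rewrite size_cat !size_flatten /shape !map_nseq !sumn_nseq -!cardE.
by rewrite cardsD cardsC1 (setIidPr A0) mulnC [X in (_ + X)%N]mulnC.
Qed.

Section Families.
Variables (m : nat) (D : 'I_m -> {set G}).

Definition internal_count z : nat := (\sum_i diff_count (D i) (D i) z)%N.

Definition external_count z : nat :=
  (\sum_i \sum_(j | j != i) diff_count (D i) (D j) z)%N.

Lemma count_internal z :
  count_mem z (flatten [seq delta (D i) | i <- enum 'I_m]) =
  ((z != 0%R) * internal_count z)%N.
Proof.
rewrite count_flatten sumnE 2!big_map big_enum /internal_count big_distrr /=.
by apply: eq_bigr => i _; rewrite count_delta.
Qed.

Lemma count_external z :
  count_mem z (flatten [seq delta2 (D i) (D j) | i <- enum 'I_m,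
                                                 j <- enum [set~ i]]) =
  external_count z.
Proof.
rewrite count_flatten sumnE big_map big_allpairs_dep big_enum /=.
apply: eq_bigr => i _; rewrite big_enum /=.
by apply: eq_big => [j|j _]; rewrite ?inE // count_delta2.
Qed.

Hypothesis disjD : forall i j, i != j -> [disjoint D i & D j].

Lemma mem_bigcup_sum x : (x \in \bigcup_i D i) = (\sum_i (x \in D i))%N :> nat.
Proof.
case: bigcupP => [[i _ xi] | xN]; last first.
  rewrite big1 // => i _; case: (boolP (x \in D i)) => // xi.
  by case: xN; exists i.
rewrite (bigD1 i) //= xi big1 // => j ji.
by rewrite (disjointFl (disjD ji) xi).
Qed.

Lemma card_bigcup_sum : #|\bigcup_i D i| = (\sum_i #|D i|)%N.
Proof.
transitivity (\sum_x (x \in \bigcup_i D i))%N.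
  by rewrite -sum1_card big_mkcond; apply: eq_bigr => x _; case: (_ \in _).
under eq_bigr do rewrite mem_bigcup_sum.
rewrite exchange_big; apply: eq_bigr => i _ /=.
by rewrite -sum1_card [RHS]big_mkcond; apply: eq_bigr => x _; case: (_ \in _).
Qed.

(** By disjointness the indicator of the union is a sum of indicators; in the expanded product the
    diagonal terms are internal, the others external. *)
Lemma diff_count_bigcup z :
  diff_count (\bigcup_i D i) (\bigcup_i D i) z =
  (internal_count z + external_count z)%N.
Proof.
rewrite /diff_count; under eq_bigr do rewrite !mem_bigcup_sum big_distrlr /=.
rewrite exchange_big /= -big_split; apply: eq_bigr => i _ /=.
by rewrite exchange_big (bigD1 i).
Qed.

(** Grouped by minuend, the count has separate terms for [x] and [y], each at least 1. *)
Lemma internal_count_ge2 x y z :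
  x != y ->
  (exists2 i, x \in D i & x - z \in D i) ->
  (exists2 i, y \in D i & y - z \in D i) ->
  (2 <= internal_count z)%N.
Proof.
have pos (t : G) : (exists2 i, t \in D i & t - z \in D i) ->
    (0 < \sum_i (t \in D i) * ((t - z)%R \in D i))%N.
  by case=> i ti tzi; rewrite (bigD1 i) //= ti tzi.
move=> xy /pos Hx /pos Hy; rewrite /internal_count /diff_count exchange_big /=.
rewrite (bigD1 x) //= (bigD1 y) ?[y == x]eq_sym //= addnA.
by apply: leq_trans (leq_addr _ _); apply: (leq_add Hx Hy).
Qed.

Lemma pds_count_internal_external v k lam mu lam' mu' :
  is_dpdf v m k lam' mu' D ->
  is_pds v #|\bigcup_i D i| lam mu (\bigcup_i D i) ->
  forall z, z != 0 ->
  (lam * (z \in \bigcup_i D i) + mu * (z \notin \bigcup_i D i) =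
   lam' * (z \in \bigcup_i D i) + mu' * (z \notin \bigcup_i D i)
   + external_count z)%N.
Proof.
move=> [_ /seq.permP intD] [_ _ /seq.permP dS] z z0.
move: (intD (pred1 z)) (dS (pred1 z)).
rewrite count_internal count_delta !count_two_valued z0 !mul1n !andbT.
by move=> <- <-; rewrite diff_count_bigcup.
Qed.

Lemma external_count0 : external_count 0 = 0%N.
Proof.
rewrite /external_count big1 // => i _; rewrite big1 // => j ji.
rewrite /diff_count big1 // => x _; rewrite subr0.
by case: (boolP (x \in D j)) => xj; rewrite ?muln0 //
  (disjointFr (disjD ji) xj).
Qed.

End Families.

(** Both sides of the multiset equality have the same size. *)
Lemma is_dpdf_double_count v m k lam mu (D : 'I_m -> {set G}) :
  is_dpdf v m k lam mu D ->
  (m * (k * k.-1) = lam * (m * k) + mu * (v.-1 - m * k))%N.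
Proof.
move=> [[cardG D0 cardD disjD] /perm_size].
rewrite size_two_valued; last by apply/bigcupsP => i _; apply: D0.
rewrite card_bigcup_sum // (eq_bigr (fun=> k)) // sum_nat_const card_ord cardG.
move=> <-; rewrite size_flatten /shape sumnE 2!big_map big_enum /=.
under eq_bigr do rewrite size_delta cardD.
by rewrite sum_nat_const card_ord.
Qed.

(** Truncation in [lam - lam'] is harmless: any [z] in the union gives
    [lam = lam' + external_count z], and otherwise that coefficient is multiplied by 0. *)
Lemma is_epdf_of_is_dpdf_of_is_pds v m k lam mu lam' (D : 'I_m -> {set G}) :
  is_dpdf v m k lam' 0 D ->
  is_pds v #|\bigcup_i D i| lam mu (\bigcup_i D i) ->
  is_epdf v m k (lam - lam') mu D.
Proof.
move=> dpdfD pdsS; have [famD _] := dpdfD; split=> //.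
have [_ D0 _ disjD] := famD.
apply/allP=> z _ /=; rewrite count_external count_two_valued; apply/eqP.
have [-> | z0] := eqVneq z 0.
  rewrite external_count0 // andbF muln0 addn0.
  case: bigcupP => [[i _ /(subsetP (D0 i))]|_]; last by rewrite muln0.
  by rewrite !inE eqxx.
have := pds_count_internal_external disjD dpdfD pdsS z0.
by case: (z \in _); rewrite ?andbT /=; lia.
Qed.

End DifferenceCounts.

(** * Cyclotomic classes described by exponents of [alpha] *)

Section CyclotomicClasses.
Set Implicit Arguments.
Unset Strict Implicit.
Variables (F : finFieldType) (alpha : F).
Hypothesis alpha_prim : primitive_element alpha.

Lemma cyclotomic_classP d i z : (d %| #|F|.-1)%N ->
  reflect (exists j, z = alpha ^+ (i + d * j)%N)
          (z \in cyclotomic_class alpha d i).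
Proof.
move=> dvd_d; have n_gt0 := prim_order_gt0 alpha_prim.
apply: (iffP imsetP) => [[j _ ->] | [j ->]].
  by exists j; rewrite exprD exprM.
have k_gt0 : (0 < #|F|.-1 %/ d)%N.
  by rewrite divn_gt0 ?(dvdn_gt0 n_gt0) // dvdn_leq.
exists (Ordinal (ltn_pmod j k_gt0)) => //=; rewrite exprD -exprM; congr (_ * _).
apply/eqP; rewrite (eq_prim_root_expr alpha_prim) -{1 3}(divnK dvd_d).
by rewrite [(_ %/ d * d)%N]mulnC -!muln_modr modn_mod.
Qed.

Arguments cyclotomic_classP {d} i z.

(** Dividing [j] by [e / eps] splits the exponent [eps * j] into [eps * i] plus a multiple of
    [e]. *)
Lemma bigcup_cyclotomic_family e eps : (e %| #|F|.-1)%N -> (eps %| e)%N ->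
  \bigcup_i cyclotomic_family alpha e eps i = cyclotomic_class alpha eps 0.
Proof.
move=> dvd_e dvd_eps; have n_gt0 := prim_order_gt0 alpha_prim.
have dvd_eps' := dvdn_trans dvd_eps dvd_e.
have e_gt0 : (0 < e)%N := dvdn_gt0 n_gt0 dvd_e.
have eps_gt0 : (0 < eps)%N := dvdn_gt0 e_gt0 dvd_eps.
have m_gt0 : (0 < e %/ eps)%N by rewrite divn_gt0 // dvdn_leq.
have eE : (e = eps * (e %/ eps))%N by rewrite mulnC divnK.
apply/setP=> z; apply/bigcupP/idP.
  case=> i _ /(cyclotomic_classP _ _ dvd_e) [j ->].
  apply/(cyclotomic_classP _ _ dvd_eps').
  by exists (i + e %/ eps * j)%N; rewrite add0n mulnDr mulnA -eE.
case/(cyclotomic_classP _ _ dvd_eps') => j ->.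
exists (Ordinal (ltn_pmod j m_gt0)) => //.
apply/(cyclotomic_classP _ _ dvd_e); exists (j %/ (e %/ eps))%N => /=.
rewrite add0n {1}(divn_eq j (e %/ eps)) addnC mulnDr.
by rewrite [(_ %/ (e %/ eps) * _)%N]mulnC mulnA -eE.
Qed.

(** For odd [k] the field has even order, so [-1 = 1]. For even [k], writing [-1 = alpha ^+ i], the
    equality [(-1) ^+ k = 1] gives [d * k %| i * k], hence [d %| i]. *)
Lemma opp1_in_cyclotomic_class d k : #|F|.-1 = (d * k)%N -> (odd k -> odd d) ->
  -1 \in cyclotomic_class alpha d 0.
Proof.
move=> nE odd_kd; have n_gt0 := prim_order_gt0 alpha_prim.
have k_gt0 : (0 < k)%N by move: n_gt0; rewrite nE muln_gt0 => /andP[].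
have dvd_d : (d %| #|F|.-1)%N by rewrite nE dvdn_mulr.
apply/(cyclotomic_classP _ _ dvd_d).
have [odd_k | even_k] := boolP (odd k).
  have : (-1 : F) ^+ #|F| = -1 := expf_card _.
  rewrite -(prednK (ltnW (finNzRing_gt1 F))) nE.
  rewrite -signr_odd /= oddM odd_k odd_kd //= => <-.
  by exists 0%N; rewrite muln0.
have pow1 j : ~~ odd j -> (-1 : F) ^+ j = 1.
  by move=> /negbTE jE; rewrite -signr_odd jE.
have even_n : ~~ odd #|F|.-1 by rewrite nE oddM (negbTE even_k) andbF.
have [i opp1E] := prim_rootP alpha_prim (pow1 _ even_n).
exists (i %/ d)%N.
rewrite add0n mulnC divnK -?opp1E //.
have /eqP := pow1 _ even_k.
rewrite opp1E -exprM -(prim_order_dvd alpha_prim) {1}nE.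
by rewrite dvdn_pmul2r.
Qed.

End CyclotomicClasses.

(** * Parameters of the cyclotomic family *)

Theorem theorem5p12 (F : finFieldType) (alpha : F)
  (q e f eps rho phi0 phi1 : nat)
  (Fq : #|F| = q) (alpha_prim : primitive_element alpha)
  (q_ef : q = (e * f + 1)%N) (q_eps_rho : q = (eps * rho + 1)%N)
  (e_gt1 : (1 < e)%N) (f_gt1 : (1 < f)%N)
  (eps_gt1 : (1 < eps)%N) (rho_gt1 : (1 < rho)%N)
  (eps_dvd_e : (eps %| e)%N) (eps_lt_e : (eps < e)%N)
  (C_dpdf : is_dpdf q (e %/ eps) f phi0 phi1 (cyclotomic_family alpha e eps)) :
  [/\ (f < eps)%N ->
        [/\ phi0 = (f - 1)%N, phi1 = 0%N
          & is_dpdf q (e %/ eps) f (f - 1) 0 (cyclotomic_family alpha e eps)],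
      (2 < eps)%N -> eps = f ->
        is_dpdf q (e %/ eps) f (f - 1) 0 (cyclotomic_family alpha e eps)
    & forall lam mu : nat,
        is_pds q rho lam mu (cyclotomic_class alpha eps 0) ->
        (f < eps)%N \/ ((2 < eps)%N /\ eps = f) ->
        [/\ (f <= lam + 1)%N,
            is_epdf q (e %/ eps) f (lam + 1 - f) mu (cyclotomic_family alpha e eps)
          & is_proper_epdf q (e %/ eps) f (lam + 1 - f) mu
              (cyclotomic_family alpha e eps)
            <-> (lam%:Z - mu%:Z <> f%:Z - 1)]].
Proof.
have nE : #|F|.-1 = (e * f)%N by rewrite Fq q_ef addn1.
have nE' : #|F|.-1 = (eps * rho)%N by rewrite Fq q_eps_rho addn1.
have dvd_e : (e %| #|F|.-1)%N by rewrite nE dvdn_mulr.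
have dvd_eps : (eps %| #|F|.-1)%N by rewrite nE' dvdn_mulr.
have [m eE] : exists m, e = (m * eps)%N by apply/dvdnP.
have mE : (e %/ eps = m)%N by rewrite eE mulnK //; lia.
have m_gt0 : (0 < m)%N by lia.
have rhoE : rho = (m * f)%N.
  by apply/eqP; rewrite -(@eqn_pmul2l eps) -?nE' ?nE ?eE; lia.
have [[_ _ _ disjC] intC] := C_dpdf.
have cover_C := bigcup_cyclotomic_family alpha_prim dvd_e eps_dvd_e.
(* The union has [m * f = rho] elements and its complement in [G^*] has [(eps - 1) * rho], so [rho]
   cancels from the double count. *)
have phiE : (f - 1 = phi0 + (eps - 1) * phi1)%N.
  have := is_dpdf_double_count C_dpdf.
  rewrite mE -Fq nE' -rhoE mulnA -rhoE => cE.
  apply/eqP; rewrite -(@eqn_pmul2l rho); last by lia.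
  rewrite subn1 cE mulnDr; apply/eqP; congr (_ + _)%N; first exact: mulnC.
  by rewrite mulnA (mulnBr rho) muln1 [(rho * eps)%N]mulnC mulnC.
have case_i : (f < eps)%N -> phi0 = (f - 1)%N /\ phi1 = 0%N.
  move=> f_lt.
  case: (posnP phi1) => [phi10 | /(leq_pmulr (eps - 1))]; last by lia.
  by move: phiE; rewrite phi10; lia.
have case_ii : (2 < eps)%N -> eps = f -> phi0 = (f - 1)%N /\ phi1 = 0%N.
  move=> eps_gt2 eps_f; case: (posnP phi1) => [phi10 | phi1_gt0].
    by move: phiE; rewrite phi10; lia.
  have phi11 : phi1 = 1%N.
    by apply/eqP; rewrite eqn_leq phi1_gt0 andbT -(@leq_pmul2l (eps - 1)); lia.
  have phi00 : phi0 = 0%N by move: phiE; rewrite phi11; lia.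
  (* Here [rho = m * eps], so [rho] odd forces [eps] odd. *)
  have opp1C : -1 \in cyclotomic_class alpha eps 0.
    apply: opp1_in_cyclotomic_class nE' _ => //.
    by rewrite rhoE oddM -eps_f => /andP[].
  pose x := alpha ^+ e.
  have x_ne1 : x - 1 != 0.
    rewrite subr_eq0 -(prim_order_dvd alpha_prim) nE.
    rewrite -[X in (_ %| X)%N](muln1 e) dvdn_pmul2l ?dvdn1; last by lia.
    by rewrite gtn_eqF.
  (* Otherwise [alpha ^+ (2 * e) = 1], so [f] divides 2, contrary to [f = eps > 2]. *)
  have x_neN1 : x != -1.
    apply/negP => /eqP xE; have : alpha ^+ (e * 2) == 1.
      by rewrite exprM -/x xE sqrrN expr1n.
    rewrite -(prim_order_dvd alpha_prim) nE dvdn_pmul2l; last by lia.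
    by move/dvdn_leq; lia.
  have : (2 <= internal_count (cyclotomic_family alpha e eps) (x - 1)%R)%N.
    apply: (internal_count_ge2 x_neN1).
      have m_gt0' : (0 < e %/ eps)%N by rewrite mE.
      exists (Ordinal m_gt0'); apply/cyclotomic_classP => //=.
        by exists 1%N; rewrite muln0 muln1.
      by exists 0%N; rewrite !muln0 subKr.
    (* The first pair was [(x, 1)] in the class of index 0. The second is [(-1, -x)]: multiplying by
       [x = alpha ^+ e] stays in the class of [-1]. *)
    move: opp1C; rewrite -cover_C => /bigcupP [i _ opp1C]; exists i => //.
    have [j opp1E] := cyclotomic_classP alpha_prim _ _ dvd_e opp1C.
    apply/cyclotomic_classP => //; exists j.+1.
    by rewrite mulnS addnCA exprD -opp1E -/x mulrN1 opprB addKr.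
  (* With [phi0 = 0] and [phi1 = 1] no multiplicity exceeds 1. *)
  have /seq.permP /(_ (pred1 (x - 1))) := intC.
  rewrite count_internal count_two_valued x_ne1 phi00 phi11.
  by case: (_ \in _) => /=; lia.
have main : (f < eps)%N \/ (2 < eps)%N /\ eps = f ->
    is_dpdf q (e %/ eps) f (f - 1) 0 (cyclotomic_family alpha e eps).
  by case=> [/case_i | [/case_ii H /H]] [<- <-].
split=> [f_lt | ? ? | lam mu pdsC f_eps]; last 1 first.
- rewrite -cover_C in pdsC; have [_ cardS _] := pdsC; rewrite -cardS in pdsC.
  have epdfC := is_epdf_of_is_dpdf_of_is_pds (main f_eps) pdsC.
  (* Evaluating the counts at an element of the union, here 1, gives
     [lam = f - 1 + external_count 1], so that [lam + 1 - f] is a true difference. *)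
  have S1 : 1 \in \bigcup_i cyclotomic_family alpha e eps i.
    by rewrite cover_C; apply/cyclotomic_classP => //; exists 0%N; rewrite muln0.
  have := pds_count_internal_external disjC (main f_eps) pdsC (oner_neq0 _).
  rewrite S1 /= !muln1 !muln0 !addn0 => lamE.
  have f_le : (f <= lam + 1)%N by clear -lamE; lia.
  have lamE' : (lam - (f - 1) = lam + 1 - f)%N by clear -f_gt1; lia.
  (* Properness fails exactly when [lam + 1 - f = mu], that is [lam - mu = f - 1]; the sign is
     opposite to that of the informal condition [mu - lam = f - 1]. *)
  rewrite lamE' in epdfC; split=> //; split=> [[_] | ne].
    by clear -f_le; lia.
  by split=> //; clear -f_le ne; lia.
- by have [-> ->] := case_i f_lt; split=> //; apply: main; left.
- by apply: main; right.
Qed.
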